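(* Consider the diffusion equation $\frac{\partial u(x,t)}{\partial t}=c\,\frac{\partial^2u(x,t)}{\partial x^2}$, where $c$ is a constant. Its forward difference scheme with a small step $h$ is $$u(x,t+h)-u(x,t)=a\bigl(u(x+2h,t)-2u(x+h,t)+u(x,t)\bigr),\qquad a=c/h.$$ Let $K$ be an inversive difference field of functions $f(x,t)$ with basic set $\sigma=\{\alpha_1,\alpha_2\}$, $\alpha_1:f(x,t)\mapsto f(x+h,t)$, $\alpha_2:f(x,t)\mapsto f(x,t+h)$, containing $a$, and let $K\{y\}^{\ast}$ be the ring of $\sigma^{\ast}$-polynomials in one $\sigma^{\ast}$-indeterminate $y$ over $K$. Treating $y$ as the unknown function $u(x,t)$, the scheme becomes the equation $A=0$ with $$A=a\alpha_1^2y-2a\alpha_1y-\alpha_2y+(a+1)y.$$ Then the $\sigma^{\ast}$-polynomial $A$ generates a linear (and therefore prime) $\sigma^{\ast}$-ideal $P=[A]^{\ast}$ of $K\{y\}^{\ast}$. With respect to the standard ranking, a characteristic set of $P$ is $\{A_1,A_2,A_3,A_4\}$, where $$A_1=A=a\alpha_1^2y-2a\alpha_1y-\alpha_2y+(a+1)y,$$ $$A_2=\alpha_1^{-1}A=-\alpha_1^{-1}\alpha_2y+a\alpha_1y+(a+1)\alpha_1^{-1}y-2ay,$$ $$A_3=\alpha_1^{-1}\alpha_2^{-1}A=a\alpha_1\alpha_2^{-1}y+(a+1)\alpha_1^{-1}\alpha_2^{-1}y-\alpha_1^{-1}y-2a\alpha_2^{-1}y,$$ $$A_4=\alpha_1^{-2}\alpha_2^{-1}A=(a+1)\alpha_1^{-2}\alpha_2^{-1}y-\alpha_1^{-2}y-2a\alpha_1^{-1}\alpha_2^{-1}y+a\alpha_2^{-1}y,$$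 with leaders $\alpha_1^2y$, $\alpha_1^{-1}\alpha_2y$, $\alpha_1\alpha_2^{-1}y$, $\alpha_1^{-2}\alpha_2^{-1}y$, respectively. The $\sigma^{\ast}$-dimension polynomial of $P$, which expresses the Einstein's strength of the forward difference scheme for the diffusion equation, is $$\psi_{Forw}(t)=5t.$$
   Context: All fields have characteristic zero. An inversive difference ($\sigma^{\ast}$-) field $K$ with basic set $\sigma=\{\alpha_1,\alpha_2\}$ is a field with commuting automorphisms $\alpha_1,\alpha_2$. $\Gamma$ is the free commutative group generated by $\sigma$. $K\{y\}^{\ast}$ is the polynomial ring over $K$ in the algebraically independent indeterminates (terms) $\gamma y$ ($\gamma\in\Gamma$, $1\cdot y=y$), on which $\Gamma$ acts by extending its action on $K$ with $\beta(\gamma y)=(\beta\gamma)y$. $[A]^{\ast}$ is the ideal generated by $\{\gamma A\mid\gamma\in\Gamma\}$; such an ideal is called linear if it is generated, together with all transforms by $\Gamma$, by homogeneous linear $\sigma^{\ast}$-polynomials. For $\gamma=\alpha_1^{k_1}\alpha_2^{k_2}$, $\mathrm{ord}\,\gamma=|k_1|+|k_2|$, and $\Gamma(r)=\{\gamma\in\Gamma\mid\mathrm{ord}\,\gamma\le r\}$. The standard ranking: $\alpha_1^{k_1}\alpha_2^{k_2}y\le\alpha_1^{l_1}\alpha_2^{l_2}y$ iff $(|k_1|+|k_2|,|k_1|,|k_2|,k_1,k_2)$ is lexicographically less than or equal to $(|l_1|+|l_2|,|l_1|,|l_2|,l_1,l_2)$. The leader $u_A$ of $A\notin K$ is the greatest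 term appearing in $A$. A term $v$ is a transform of a term $u$ if $v=\gamma u$ where $\gamma$ and the exponent vectors of $u$ and $v$ all lie in one common orthant of $\mathbb{Z}^2$ (orthants are products of two factors each equal to $\mathbb{N}=\{0,1,\dots\}$ or $\{a\in\mathbb{Z}\mid a\le0\}$; $\gamma=\alpha_1^{k_1}\alpha_2^{k_2}$ is identified with $(k_1,k_2)$). $\mathrm{rk}\,A>\mathrm{rk}\,B$ if $A\notin K$ and $B\in K$, or $u_A>u_B$, or $u_A=u_B$ and $\deg_{u_A}A>\deg_{u_A}B$; ranks are equal if leaders and degrees in them coincide. $A$ is reduced with respect to $B$ if $A$ contains no power of a transform of $u_B$ (including $u_B$) with exponent $\ge\deg_{u_B}B$. A set is autoreduced if it is empty, or it is disjoint from $K$ and each element is reduced with respect to all others. Autoreduced sets are finite, written in order of increasing rank; $\{A_1,\dots,A_p\}$ has lower rank than $\{B_1,\dots,B_q\}$ if for some $k\le\min\{p,q\}$, $\mathrm{rk}\,A_i=\mathrm{rk}\,B_i$ for $i<k$ and $\mathrm{rk}\,A_k<\mathrm{rk}\,B_k$, or $p>q$ and $\mathrm{rk}\,A_i=\mathrm{rk}\,B_i$ for $i\le q$. A characteristic set of an ideal is an autoreduced subset of it of lowest rank. The $\sigma^{\ast}$-dimension polynomial of a prime $\sigma^{\ast}$-ideal $P$ of $K\{y\}^{\ast}$ is the unique polynomial $\psi(t)\in\mathbb{Q}[t]$ such that $\psi(r)=\mathrm{tr.deg}_KK(\{\gamma\eta\mid\gamma\in\Gamma(r)\})$ for all sufficiently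 large $r\in\mathbb{N}$, where $\eta$ is the canonical image of $y$ in the quotient field of $K\{y\}^{\ast}/P$.
   Formalization: The constant a = c/h is assumed to be different from 0 and from −1; for c = 0 the term α₁²y disappears from A, and for c = −h the term α₁⁻²α₂⁻¹y disappears from A₄, so the stated leaders would be wrong. *)

(* Defs.v *)
From HB Require Import structures.
From mathcomp Require Import all_boot all_order all_algebra.
From mathcomp Require Import finmap monalg.
From mathcomp Require Import boolp classical_sets.

Set Implicit Arguments.
Unset Strict Implicit.
Unset Printing Implicit Defensive.

Import Order.TTheory GRing.Theory Num.Theory.

Local Open Scope classical_set_scope.
Local Open Scope quotient_scope.
Local Open Scope ring_scope.

Record inversive_difference_field := InversiveDifferenceField {
  idf_field :> fieldType;
  idf_char0 : [pchar idf_field] =i pred0;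
  alpha1 : {rmorphism idf_field -> idf_field};
  alpha1V : {rmorphism idf_field -> idf_field};
  alpha2 : {rmorphism idf_field -> idf_field};
  alpha2V : {rmorphism idf_field -> idf_field};
  alpha1K : cancel alpha1 alpha1V;
  alpha1VK : cancel alpha1V alpha1;
  alpha2K : cancel alpha2 alpha2V;
  alpha2VK : cancel alpha2V alpha2;
  alphaC : forall c : idf_field, alpha1 (alpha2 c) = alpha2 (alpha1 c) }.

(* alpha1 ^ k1 * alpha2 ^ k2 is represented by its exponent vector (k1, k2),
   so the group law of Gamma is written additively.  The same vectors index
   the terms: the term (gamma y) is represented by gamma. *)
Notation Gamma := (int * int)%type.

Definition ordG (g : Gamma) : nat := (`|g.1| + `|g.2|)%N.

Definition iterz (T : Type) (f fV : T -> T) (k : int) : T -> T :=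
  match k with Posz n => iter n f | Negz n => iter n.+1 fV end.

Definition actK (K : inversive_difference_field) (g : Gamma) (c : K) : K :=
  iterz (@alpha1 K) (@alpha1V K) g.1 (iterz (@alpha2 K) (@alpha2V K) g.2 c).

(* Value at b of a polynomial in indeterminates indexed by I, the coefficients
   being mapped by f. *)
Definition evalm (I : choiceType) (R : nzRingType) (S : comNzRingType)
    (f : R -> S) (b : I -> S) (p : {malg R[{cmonom I}]}) : S :=
  mmap f (fun m : {cmonom I} => \prod_(i <- finsupp m) b i ^+ m i) p.

(* the ring K{y}^*; its indeterminates are the terms *)
Notation sigma_poly K := {malg (idf_field K)[{cmonom Gamma}]}.

Section SigmaPolynomials.
Variable K : inversive_difference_field.
Implicit Types (A B C : sigma_poly K) (u v g : Gamma) (S T J : set (sigma_poly K)).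

Definition term (g : Gamma) : sigma_poly K := << ucm g >>.

Definition act (g : Gamma) (B : sigma_poly K) : sigma_poly K :=
  evalm (fun c : K => (actK g c)%:MP : sigma_poly K) (fun u => term (g + u)) B.

Definition constant B := exists c : K, B = c%:MP.

Definition is_ideal J :=
  [/\ J 0, forall B C, J B -> J C -> J (B + C)
    & forall B C, J C -> J (B * C)].

Definition is_sigma_ideal J :=
  is_ideal J /\ forall g B, J B -> J (act g B).

Definition is_prime_ideal J :=
  [/\ is_ideal J, ~ J 1 & forall B C, J (B * C) -> J B \/ J C].

(* the set [S]^* of combinations of transforms of elements of S *)
Definition sigma_gen S : set (sigma_poly K) :=
  [set B | exists s : seq (sigma_poly K * Gamma * sigma_poly K),
     (forall x, x \in s -> S x.2) /\
     B = \sum_(x <- s) x.1.1 * act x.1.2 x.2].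

Definition homogeneous_linear B := forall m, m \in msupp B -> mdeg m = 1%N.

Definition is_linear_ideal J :=
  exists S, (forall B, S B -> homogeneous_linear B) /\ J = sigma_gen S.

(* sequences of integers are compared lexicographically in [seqlexi] *)
Definition rank_key (u : Gamma) : seqlexi int :=
  [:: `|u.1| + `|u.2|; `|u.1|; `|u.2|; u.1; u.2].
Definition term_le u v : bool := (rank_key u <= rank_key v)%O.
Definition term_lt u v : bool := (rank_key u < rank_key v)%O.

Definition appears u B := exists2 m, m \in msupp B & (0 < m u)%N.

Definition is_leader B u :=
  appears u B /\ forall v, appears v B -> term_le v u.

Definition deg_in u B : nat := (\max_(m <- msupp B) m u)%N.

(* The booleans select, for each coordinate, the nonnegative or the
   nonpositive integers. *)
Definition in_orthant (e : bool * bool) (k : Gamma) : bool :=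
  (if e.1 then 0 <= k.1 else k.1 <= 0) && (if e.2 then 0 <= k.2 else k.2 <= 0).

Definition is_transform v u := exists g (e : bool * bool),
  v = g + u /\ [/\ in_orthant e g, in_orthant e u & in_orthant e v].

Definition rk_lt B C :=
  (constant B /\ ~ constant C) \/
  exists u v, [/\ is_leader B u, is_leader C v
    & term_lt u v \/ u = v /\ (deg_in u B < deg_in u C)%N].

Definition rk_eq B C :=
  exists u, [/\ is_leader B u, is_leader C u & deg_in u B = deg_in u C].

Definition reduced B C := exists u,
  is_leader C u /\ forall v, is_transform v u -> (deg_in v B < deg_in u C)%N.

Definition autoreduced S :=
  (forall B, S B -> ~ constant B) /\
  (forall B C, S B -> S C -> B <> C -> reduced B C).

Definition increasing_listing S (s : seq (sigma_poly K)) :=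
  S = [set B | B \in s] /\
  forall i j, (i < j < size s)%N -> rk_lt s`_i s`_j.

Definition lower_rank S T := exists s t,
  [/\ increasing_listing S s, increasing_listing T t &
   (exists k, [/\ (k < minn (size s) (size t))%N,
       forall i, (i < k)%N -> rk_eq s`_i t`_i & rk_lt s`_k t`_k]) \/
   ((size t < size s)%N /\ forall i, (i < size t)%N -> rk_eq s`_i t`_i)].

(* [lower_rank S T] is false if S or T is infinite, but autoreduced sets are
   always finite. *)
Definition is_characteristic_set J S :=
  [/\ autoreduced S, S `<=` J
    & forall T, autoreduced T -> T `<=` J -> ~ lower_rank T S].

End SigmaPolynomials.

Section ResidueRing.
Variables (K : inversive_difference_field) (P : set (sigma_poly K)).
Hypothesis hP : is_prime_ideal P.

Definition prime_pred (h : is_prime_ideal P) : sigma_poly K -> bool :=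
  fun B => `[< P B >].

Lemma prime_pred_idealr : idealr_closed (prime_pred hP).
Proof.
have [[P0 PD PM] P1 _] := hP; split; first exact/asboolP.
  by apply/negP => /asboolP.
move=> a B C /asboolP PB /asboolP PC; apply/asboolP/PD => //.
exact: PM.
Qed.

Lemma prime_pred_prime : prime_idealr_closed (prime_pred hP).
Proof.
have [_ _ Ppr] := hP => B C /asboolP /Ppr PBC.
by apply/orP; case: PBC => ?; [left|right]; apply/asboolP.
Qed.

HB.instance Definition _ :=
  isIdealr.Build (sigma_poly K) (prime_pred hP) prime_pred_idealr.
HB.instance Definition _ :=
  isPrimeIdealrClosed.Build (sigma_poly K) (prime_pred hP) prime_pred_prime.

Definition prime_ideal : prime_idealr (sigma_poly K) := prime_pred hP.

Definition residue_ring : Type := {ideal_quot prime_ideal}.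
HB.instance Definition _ := GRing.ComNzRing.on residue_ring.

(* {fraction _} needs an integral domain with a unit predicate and an inverse;
   both are chosen classically. *)
Definition residue_unit : pred residue_ring :=
  fun x => `[< exists y, y * x = 1 >].

Definition residue_inv (x : residue_ring) : residue_ring :=
  if pselect (exists y, y * x = 1) is left h then projT1 (cid h) else x.

Lemma residue_mulVr : {in residue_unit, left_inverse 1 residue_inv *%R}.
Proof.
move=> x /asboolP ux; rewrite /residue_inv; case: pselect => // h.
by case: (cid h).
Qed.

Lemma residue_unitP (x y : residue_ring) : y * x = 1 -> residue_unit x.
Proof. by move=> yx; apply/asboolP; exists y. Qed.

Lemma residue_invr_out : {in [predC residue_unit], residue_inv =1 id}.
Proof.
move=> x /negP ux; rewrite /residue_inv; case: pselect => // h.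
by case: ux; apply/asboolP.
Qed.

HB.instance Definition _ := GRing.ComNzRing_hasMulInverse.Build residue_ring
  residue_mulVr residue_unitP residue_invr_out.
HB.instance Definition _ := GRing.ComUnitRing_isIntegral.Build residue_ring
  (@Quotient.rquot_IdomainAxiom _ prime_ideal).

Definition residue_field : fieldType := {fraction residue_ring}.

Definition residue (B : sigma_poly K) : residue_field :=
  tofrac (\pi_{ideal_quot prime_ideal} B : residue_ring).

End ResidueRing.

Section TranscendenceDegree.
Variables (k F : fieldType) (iota : k -> F).

(* the subfield k(S) of F *)
Definition adjoin (S : set F) : set F :=
  [set x | forall E : {pred F}, divring_closed E ->
     (forall c, iota c \in E) -> (forall s, S s -> s \in E) -> x \in E].

Definition algebraically_independent (I : choiceType) (b : I -> F) :=
  forall p : {malg k[{cmonom I}]}, evalm iota b p = 0 -> p = 0.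

Definition algebraic_over (E : set F) (x : F) :=
  exists p : {poly F}, [/\ p != 0, forall i, E p`_i & root p x].

(* The extension L of k inside F has a transcendence basis with n elements. *)
Definition has_trdeg (L : set F) (n : nat) :=
  exists b : 'I_n -> F,
    [/\ forall i, L (b i), algebraically_independent b
      & forall x, L x -> algebraic_over (adjoin (range b)) x].

End TranscendenceDegree.

(* By the invariance of the cardinality of transcendence bases, at most one
   polynomial psi satisfies this. *)
Definition is_dimension_polynomial (K : inversive_difference_field)
    (P : set (sigma_poly K)) (psi : {poly rat}) :=
  exists hP : is_prime_ideal P, exists r0 : nat, forall r : nat, (r0 <= r)%N ->
  exists n : nat, psi.[r%:R] = n%:R /\
    has_trdeg (fun c : K => residue hP c%:MP)
      (adjoin (fun c : K => residue hP c%:MP)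
         [set residue hP (term K g) | g in [set g | (ordG g <= r)%N]]) n.

(* Main.v *)
Require Import Defs.
From HB Require Import structures.
From mathcomp Require Import all_boot all_order all_algebra.
From mathcomp Require Import finmap monalg.
From mathcomp Require Import boolp classical_sets.
From mathcomp Require Import zify ring.

(* The transform of A by g has leader g + lead_shift g, and this leader determines
   g.  The terms that are not such leaders are
     (0, k), (1, m), (-1, - m), (- m, 0)   with m >= 0.
   Rewriting leaders with the scheme sends every term to a linear combination of
   non-leaders.  Extended to a ring morphism, this normal form has kernel
   P = [A]^*; so K{y}^*/P is the polynomial ring in the non-leaders and P is prime.
   An element of P that contains no leader is its own normal form, hence is zero:
   this is why no autoreduced subset of P has lower rank than {A1, A2, A3, A4}.
   Rewriting does not increase the order of terms, so the transcendence degree in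
   order r is the number 5 r of non-leaders of order at most r. *)

Set Implicit Arguments.
Unset Strict Implicit.
Unset Printing Implicit Defensive.

Import Order.TTheory GRing.Theory Num.Theory.

Local Open Scope classical_set_scope.
Local Open Scope ring_scope.

(** * Evaluation of polynomials in infinitely many indeterminates *)

Section MonomialEvaluation.
Variables (I : choiceType) (S : comNzRingType) (b : I -> S).

Definition mon_eval (m : {cmonom I}) : S := \prod_(i <- finsupp m) b i ^+ m i.

Lemma mon_eval_widen (d : {fset I}) (m : {cmonom I}) : (finsupp m `<=` d)%fset ->
  mon_eval m = \prod_(i <- d) b i ^+ m i.
Proof.
move=> md; rewrite /mon_eval (big_fset_incl _ md) // => i _.
by rewrite -cmE_eq0 => /eqP ->; rewrite expr0.
Qed.

Lemma mon_evalU i : mon_eval (ucm i) = b i.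
Proof. by rewrite /mon_eval mdomU big_seq_fset1 cmUU expr1. Qed.

Lemma mon_eval_is_multiplicative : mmorphism mon_eval.
Proof.
split=> [m1 m2|]; last by rewrite /mon_eval mdom1 big_seq_fset0.
rewrite /= [LHS]/mon_eval mdomD.
rewrite (mon_eval_widen (fsubsetUl (finsupp m1) (finsupp m2))).
rewrite (mon_eval_widen (fsubsetUr (finsupp m1) (finsupp m2))).
by rewrite -big_split; apply: eq_bigr => i _; rewrite cmM exprD.
Qed.

HB.instance Definition _ :=
  isMultiplicative.Build {cmonom I} S mon_eval mon_eval_is_multiplicative.

End MonomialEvaluation.

Section Evaluation.
Variables (I : choiceType) (R : nzRingType) (S : comNzRingType).
Implicit Types (f : {rmorphism R -> S}) (b : I -> S).

HB.instance Definition _ f b :=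
  GRing.RMorphism.copy (evalm f b) (mmap f (mon_eval b)).

Lemma evalmE (f : R -> S) b p :
  evalm f b p = \sum_(m <- msupp p) f p@_m * mon_eval b m.
Proof. by []. Qed.

Lemma evalmU f b i : evalm f b << ucm i >> = b i.
Proof. by rewrite /evalm mmapU /= rmorph1 mul1r -/(mon_eval b _) mon_evalU. Qed.

Lemma evalmC f b c : evalm f b c%:MP = f c.
Proof. exact: (@mmapC _ _ _ f (mon_eval b)). Qed.

Lemma evalmZ f b c p : evalm f b (c *: p) = f c * evalm f b p.
Proof. exact: (@mmapZ _ _ _ f (mon_eval b)). Qed.

End Evaluation.

Lemma rmorph_evalm (I : choiceType) (R : nzRingType) (S T : comNzRingType)
    (h : {rmorphism S -> T}) (f : R -> S) (g : R -> T) (b : I -> S) p :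
  (forall c, h (f c) = g c) ->
  h (evalm f b p) = evalm g (h \o b) p.
Proof.
move=> hf; rewrite !evalmE rmorph_sum; apply: eq_bigr => m _.
rewrite rmorphM hf rmorph_prod; congr (_ * _).
by apply: eq_bigr => i _; rewrite rmorphXn.
Qed.

Lemma eq_evalm (I : choiceType) (R : nzRingType) (S : comNzRingType)
    (f : R -> S) (b b' : I -> S) (p : {malg R[{cmonom I}]}) :
  (forall (m : {cmonom I}) i, m \in msupp p -> (0 < m i)%N -> b i = b' i) ->
  evalm f b p = evalm f b' p.
Proof.
move=> bb'; rewrite !evalmE big_seq [RHS]big_seq; apply: eq_bigr => m mp.
congr (_ * _); rewrite /mon_eval big_seq [RHS]big_seq; apply: eq_bigr => i im.
by rewrite (bb' m) // lt0n cmE_neq0.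
Qed.

Lemma malgU_mmul (M : monomType) (R : nzRingType) (m1 m2 : M) :
  << m1 >> * << m2 >> = << mmul m1 m2 >> :> {malg R[M]}.
Proof. by rewrite malgM_def fgmulUU mulr1. Qed.

Lemma ucm_expE (I : choiceType) (R : nzRingType) (i : I) (n : nat) :
  exists2 m : {cmonom I}, << ucm i >> ^+ n = << m >> :> {malg R[{cmonom I}]}
    & forall j, m j = (n * (i == j))%N.
Proof.
elim: n => [|n [m em mE]].
  by exists mone => [|j]; [rewrite expr0 | rewrite cm1].
exists (mmul (ucm i) m) => [|j].
  by rewrite exprS {}em malgU_mmul.
by rewrite cmM cmU mE mulSn.
Qed.

Lemma ucm_prodE (I : choiceType) (R : nzRingType) (n : I -> nat) (s : seq I) :
  exists2 m : {cmonom I},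
    \prod_(i <- s) << ucm i >> ^+ n i = << m >> :> {malg R[{cmonom I}]}
    & forall j, m j = (\sum_(i <- s) n i * (i == j))%N.
Proof.
elim: s => [|i s [m em mE]].
  by exists mone => [|j]; rewrite big_nil ?cm1.
have [m' em' m'E] := ucm_expE R i (n i).
exists (mmul m' m) => [|j].
  by rewrite big_cons {}em {}em' malgU_mmul.
by rewrite big_cons cmM m'E mE.
Qed.

Lemma mon_eval_ucm (I : choiceType) (R : comNzRingType) (m : {cmonom I}) :
  mon_eval (fun i => << ucm i >>) m = << m >> :> {malg R[{cmonom I}]}.
Proof.
rewrite /mon_eval; have [m' -> m'E] := ucm_prodE R m (finsupp m).
congr << _ >>; apply/eqP/cmP => j; rewrite m'E.
case: (boolP (j \in finsupp m)) => jm.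
  rewrite (big_fsetD1 _ jm) /= eqxx muln1 big_seq big1 ?addn0 // => i.
  by rewrite in_fsetD1 => /andP[/negPf-> _]; rewrite muln0.
rewrite big_seq big1 => [|i im]; first by rewrite -cmE_eq0 in jm; rewrite (eqP jm).
by case: eqP => [ij|]; [rewrite -ij im in jm | rewrite muln0].
Qed.

Lemma evalm_id (I : choiceType) (R : comNzRingType) (p : {malg R[{cmonom I}]}) :
  evalm (@malgC {cmonom I} R) (fun i => << ucm i >>) p = p.
Proof.
rewrite evalmE [RHS]monalgE; apply: eq_bigr => m _.
rewrite mul_malgC mon_eval_ucm; apply/malgP => k.
by rewrite mcoeffZ [RHS]mcoeffU [X in _ * X]mcoeffU mulr_natr.
Qed.

(** * Monomials read as numbers in base [N] *)

Section Kronecker.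
Variables (I : choiceType) (N : nat).

Fixpoint digits_value (s : seq I) (m : {cmonom I}) : nat :=
  if s is i :: s' then (m i + N * digits_value s' m)%N else 0%N.

(** Uniqueness of base [N] expansions: reduction modulo [N] recovers the first digit, and cancelling
    it leaves the same equation for the remaining ones. *)
Lemma digits_value_inj s (m m' : {cmonom I}) :
  (forall i, m i < N)%N -> (forall i, m' i < N)%N ->
  digits_value s m = digits_value s m' -> {in s, m =1 m'}.
Proof.
move=> mN m'N; elim: s => //= i s IHs e.
have N0 : (0 < N)%N by apply: leq_ltn_trans (mN i).
have ei : m i = m' i.
  move/(congr1 (modn^~ N)): (e).
  by rewrite [in LHS]addnC [in RHS]addnC ![(N * _)%N]mulnC !modnMDl !modn_small.
have /IHs IH : digits_value s m = digits_value s m'.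
  by move: e; rewrite ei => /addnI/eqP; rewrite eqn_pmul2l // => /eqP.
by move=> j; rewrite inE => /predU1P[->|/IH].
Qed.

(** Without repetitions in [s], [index i s] is the position of the digit [m i]. *)
Lemma digits_valueE s m : uniq s ->
  digits_value s m = (\sum_(i <- s) N ^ index i s * m i)%N.
Proof.
elim: s => [|i s IHs] /=; first by rewrite big_nil.
move=> /andP[si us]; rewrite big_cons /= eqxx expn0 mul1n IHs // big_distrr /=.
congr addn; rewrite big_seq [RHS]big_seq; apply: eq_bigr => j js.
by case: eqP => [e|_]; [rewrite e js in si | rewrite expnS mulnA].
Qed.

End Kronecker.

(* Kronecker substitution: for N large, i |-> 'X^(N^(rank of i)) maps the
   finitely many monomials at hand to distinct powers of 'X. *)
Lemma malg_mulf_eq0 (I : choiceType) (R : idomainType)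
    (p q : {malg R[{cmonom I}]}) : p * q = 0 -> p = 0 \/ q = 0.
Proof.
pose ms := (msupp p ++ msupp q : seq {cmonom I}).
pose vars (m : {cmonom I}) : seq I := finsupp m.
pose s := undup (flatten [seq vars m | m <- ms]).
(* The successor puts every exponent strictly below [N], so that exponents are genuine digits. *)
pose N := (\max_(m <- ms) \max_(i <- s) (m : {cmonom I}) i).+1.
pose b i : {poly R} := 'X^(N ^ index i s).
have finsupp_s (m : {cmonom I}) : m \in ms -> {subset finsupp m <= s}.
  move=> mms i im; rewrite mem_undup; apply/flattenP.
  by exists (vars m) => //; apply/mapP; exists m.
have m_lt (m : {cmonom I}) : m \in ms -> forall i, (m i < N)%N.
  move=> mms i; rewrite ltnS; case: (boolP (i \in finsupp m)) => [im|].
    apply: leq_trans (leq_bigmax_seq _ mms isT).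
    exact: (@leq_bigmax_seq _ s xpredT (fun i => m i) i (finsupp_s m mms i im) isT).
  by rewrite -cmE_eq0 => /eqP->.
have bE m : m \in ms -> mon_eval b m = 'X^(digits_value N s m).
  move=> mms; rewrite digits_valueE ?undup_uniq // /mon_eval.
  under eq_bigr do rewrite -exprM.
  rewrite -(big_morph _ (exprD 'X) (expr0 'X)); congr ('X^ _).
  rewrite [RHS](bigID (mem (finsupp m))) /= [X in (_ + X)%N]big1 ?addn0.
    rewrite -[RHS]big_filter; apply: perm_big; apply: uniq_perm.
    - exact: fset_uniq.
    - exact/filter_uniq/undup_uniq.
    - move=> i; rewrite mem_filter; case: (boolP (i \in finsupp m)) => //.
      by move=> /(finsupp_s _ mms) ->.
  by move=> i; rewrite -cmE_eq0 => /eqP->; rewrite muln0.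
have inj (m m' : {cmonom I}) : m \in ms -> m' \in ms ->
    digits_value N s m = digits_value N s m' -> m = m'.
  move=> mms m'ms /(digits_value_inj (m_lt _ mms) (m_lt _ m'ms)) e.
  apply/eqP/cmP => i; case: (boolP (i \in s)) => [/e //|si].
  have nf (m1 : {cmonom I}) : m1 \in ms -> m1 i = 0%N.
    by move=> m1s; apply/eqP; rewrite cmE_eq0; apply: contra si; apply: finsupp_s.
  by rewrite !nf.
have ev0 (r : {malg R[{cmonom I}]}) : {subset msupp r <= ms} ->
    evalm (@polyC R) b r = 0 -> r = 0.
  move=> rs r0; apply/eqP; rewrite -msupp_eq0; apply/negPn/negP => /fset0Pn[m0 m0r].
  (* By [inj], no other monomial of [r] contributes in this degree, so the nonzero coefficient of
     [m0] survives. *)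
  have : (evalm (@polyC R) b r)`_(digits_value N s m0) = r@_m0.
    rewrite evalmE coef_sum (big_fsetD1 _ m0r) /=.
    rewrite bE ?rs // coefCM coefXn eqxx mulr1 big_seq big1 ?addr0 // => m.
    rewrite in_fsetD1 => /andP[mm0 mr]; rewrite bE ?rs // coefCM coefXn.
    case: eqP => [/inj e|]; last by rewrite mulr0.
    by rewrite e ?rs ?eqxx in mm0.
  rewrite r0 coef0 => /esym/eqP; rewrite mcoeff_eq0 m0r //.
move=> pq0; have /eqP : evalm (@polyC R) b p * evalm (@polyC R) b q = 0.
  by rewrite -rmorphM pq0 rmorph0.
rewrite mulf_eq0 => /orP[]/eqP /ev0 e; [left|right]; apply: e => m;
  by rewrite mem_cat => ->; rewrite ?orbT.
Qed.

(** * Leaders of the transforms of the scheme *)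

Definition shifts : seq Gamma := [:: (2, 0); (1, 0); (0, 1); (0, 0)].

(** The leading term has strictly greatest order, except for [g = (-1, k)] with [k < 0]: there
    [(1, k)] and [(-1, k)] have equal order and the sign of the first exponent decides. *)
Definition lead_shift (g : Gamma) : Gamma :=
  if 0 <= g.1 then (2, 0) else if 0 <= g.2 then (0, 1)
  else if g.1 == -1 then (2, 0) else (0, 0).

(* [head_of w] is the index [g] such that [w] is the leader of the scheme at [g],
   and [None] if [w] is not a leader. *)
Definition head_of (w : Gamma) : option Gamma :=
  if (2 <= w.1) || ((w.1 == 1) && (w.2 < 0)) then Some (w.1 - 2, w.2)
  else if (w.1 < 0) && (0 < w.2) then Some (w.1, w.2 - 1)
  else if (w.1 <= -2) && (w.2 < 0) then Some w else None.

(* The tie-break is needed for the leader (1, k) with k < 0, since the scheme at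
   (-1, k) also contains the term (-1, k) of the same order. *)
Definition weight (w : Gamma) : nat := (ordG w + ordG w + (0 < w.1)%R)%N.

Lemma addGE (g d : Gamma) : g + d = (g.1 + d.1, g.2 + d.2).
Proof. by []. Qed.

Lemma lead_shift_in g : lead_shift g \in shifts.
Proof. by rewrite /lead_shift; do 3?case: ifP. Qed.

Lemma head_of_lead g : head_of (g + lead_shift g) = Some g.
Proof.
case: g => g1 g2; rewrite /lead_shift /=.
by do 3?[case: ifP => ?]; rewrite /head_of /=; do 3?[case: ifP => ?];
  first [exfalso; lia | by rewrite addr0 | congr (Some (_, _)); lia].
Qed.

Lemma head_ofK w g : head_of w = Some g -> w = g + lead_shift g.
Proof.
case: w => w1 w2; rewrite /head_of /=.
by do 3?[case: ifP => ?] => // -[<-]; rewrite addGE /lead_shift /=;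
  do 3?[case: ifP => ?]; first [exfalso; lia | congr (_, _) => /=; lia].
Qed.

(** This makes the rewriting of leaders terminate. Orders are doubled in [weight], so a drop in
    order outweighs the tie-break. *)
Lemma weight_lead g d : d \in shifts -> d != lead_shift g ->
  (weight (g + d)%R < weight (g + lead_shift g)%R)%N.
Proof.
case: g => g1 g2; rewrite !inE /weight /ordG /lead_shift !addGE /=.
by case/or4P => /eqP -> /=; do 3?[case: ifP => ? /=]; move=> //= _; lia.
Qed.

Lemma weight_ordG w v : (weight w < weight v)%N -> (ordG w <= ordG v)%N.
Proof. rewrite /weight; case: (0 < w.1)%R; case: (0 < v.1)%R; lia. Qed.

(** * Transforms and ideals *)

Lemma iterz_ind (T : Type) (Q : (T -> T) -> Prop) (f fV : T -> T) (k : int) :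
  Q id -> (forall h, Q h -> Q (f \o h)) -> (forall h, Q h -> Q (fV \o h)) ->
  Q (iterz f fV k).
Proof.
move=> Qid Qf QfV; case: k => n /=.
  by elim: n => //= n IHn; apply: Qf IHn.
by elim: n => /= [|n IHn]; [apply: QfV Qid | apply: QfV IHn].
Qed.

Section Action.
Variable K : inversive_difference_field.
Implicit Types (g : Gamma) (c : K) (B : sigma_poly K).

(** An element of [Gamma] acts as a composite of field endomorphisms, so the morphism laws follow by
    induction on the composite, whatever the signs of the exponents. *)
Lemma actK_ind (Q : (K -> K) -> Prop) g :
  Q id -> (forall (f : {rmorphism K -> K}) h, Q h -> Q (f \o h)) -> Q (actK g).
Proof.
move=> Qid Qf; pose h2 := iterz (alpha2 K) (alpha2V K) g.2.
have Q2 : Q h2 by apply: iterz_ind => // h Qh; apply: Qf.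
apply: (@iterz_ind _ (fun h => Q (h \o h2))) => // h Qh.
- exact: (Qf (alpha1 K) (h \o h2)).
- exact: (Qf (alpha1V K) (h \o h2)).
Qed.

Lemma actK_is_zmod_morphism g : zmod_morphism (@actK K g).
Proof. by apply: actK_ind => // f h hB x y /=; rewrite hB rmorphB. Qed.

Lemma actK_is_monoid_morphism g : monoid_morphism (@actK K g).
Proof.
by apply: actK_ind => // f h [h1 hM]; split=> [|x y] /=; rewrite ?h1 ?hM ?rmorph1 ?rmorphM.
Qed.

HB.instance Definition _ g :=
  GRing.isZmodMorphism.Build K K (@actK K g) (@actK_is_zmod_morphism g).
HB.instance Definition _ g :=
  GRing.isMonoidMorphism.Build K K (@actK K g) (@actK_is_monoid_morphism g).

Lemma actK_fixed g c : alpha1 K c = c -> alpha2 K c = c -> actK g c = c.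
Proof.
move=> c1 c2; have c1V : alpha1V K c = c by rewrite -[in LHS]c1 alpha1K.
have c2V : alpha2V K c = c by rewrite -[in LHS]c2 alpha2K.
rewrite /actK; apply: (@iterz_ind _ (fun h => h _ = c)) => [|h|h] /=.
- by apply: (@iterz_ind _ (fun h => h c = c)) => [|h|h] //= ->.
- by move=> ->.
- by move=> ->.
Qed.

HB.instance Definition _ g := GRing.RMorphism.copy (@act K g)
  (evalm (@malgC {cmonom Gamma} K \o @actK K g) (fun u => term K (g + u))).

Lemma act_term g u : act g (term K u) = term K (g + u).
Proof. exact: (evalmU (@malgC {cmonom Gamma} K \o @actK K g)). Qed.

Lemma actZ g c B : act g (c *: B) = actK g c *: act g B.
Proof.
rewrite -[RHS]mul_malgC; exact: (evalmZ (@malgC {cmonom Gamma} K \o @actK K g)).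
Qed.

Lemma sigma_gen_ideal (S : set (sigma_poly K)) : is_ideal (sigma_gen S).
Proof.
split=> [|B C [s [sS ->]] [t [tS ->]]|B C [s [sS ->]]].
- by exists [::]; rewrite big_nil.
- exists (s ++ t); split=> [x|]; last by rewrite big_cat.
  by rewrite mem_cat => /orP[/sS|/tS].
- exists [seq (B * x.1.1, x.1.2, x.2) | x <- s]; split=> [x|].
    by case/mapP => y /sS Sy ->.
  by rewrite big_map big_distrr; apply: eq_bigr => x _ /=; rewrite mulrA.
Qed.

Lemma sigma_gen_act (S : set (sigma_poly K)) g B : S B -> sigma_gen S (act g B).
Proof.
move=> SB; exists [:: (1, g, B)]; split=> [x|]; last by rewrite big_seq1 mul1r.
by rewrite inE => /eqP ->.
Qed.

End Action.

Section Ideal.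
Variables (K : inversive_difference_field) (J : set (sigma_poly K)).
Hypothesis idealJ : is_ideal J.
Implicit Types B C : sigma_poly K.

Lemma ideal0 : J 0. Proof. by case: idealJ. Qed.
Lemma idealD B C : J B -> J C -> J (B + C). Proof. by case: idealJ => _ + _; apply. Qed.
Lemma idealMl B C : J C -> J (B * C). Proof. by case: idealJ => _ _; apply. Qed.
Lemma idealZ c B : J B -> J (c *: B). Proof. by rewrite -mul_malgC; apply: idealMl. Qed.
Lemma ideal_sum (T : eqType) (s : seq T) (F : T -> sigma_poly K) :
  (forall x, x \in s -> J (F x)) -> J (\sum_(x <- s) F x).
Proof.
move=> JF; rewrite big_seq; apply: (@big_ind _ J) => //; first exact: ideal0.
exact: idealD.
Qed.

(** Congruence modulo an ideal respects products, hence powers and whole monomials; the coefficients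
    are the same on both sides. *)
Lemma evalm_congr (b b' : Gamma -> sigma_poly K) B :
  (forall w, J (b w - b' w)) ->
  J (evalm (@malgC {cmonom Gamma} K) b B - evalm (@malgC {cmonom Gamma} K) b' B).
Proof.
move=> bb'; rewrite !evalmE -sumrB; apply: ideal_sum => m _.
rewrite -mulrBr; apply: idealMl.
have JM x x' y y' : J (x - x') -> J (y - y') -> J (x * y - x' * y').
  move=> Jx Jy; have -> : x * y - x' * y' = y * (x - x') + x' * (y - y') by ring.
  by apply: idealD; apply: idealMl.
apply: (@big_ind2 _ _ (fun x y => J (x - y))) => [|x x' y y'|w _].
- by rewrite subrr; apply: ideal0.
- exact: JM.
elim: (m w) => [|n IHn]; first by rewrite subrr; apply: ideal0.
by rewrite !exprS; apply: JM.
Qed.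

End Ideal.

(** * Normal forms *)

(** Well-founded recursion by iteration: when [step] at [w] consults only values of smaller rank,
    any number of iterations above [rk w] gives the same value at [w]. *)
Lemma iter_stable (W V : Type) (rk : W -> nat) (step : (W -> V) -> W -> V) :
  (forall f f' w, (forall v, (rk v < rk w)%N -> f v = f' v) ->
     step f w = step f' w) ->
  forall f n m w, (rk w < n)%N -> (rk w < m)%N ->
  iter n step f w = iter m step f w.
Proof.
move=> step_ext f; elim=> [//|n IHn] [//|m] w wn wm.
rewrite !iterS; apply: step_ext => v vw.
by apply: IHn; apply: leq_trans vw _.
Qed.

Section Scheme.
Variables (K : inversive_difference_field) (a : K).
Implicit Types (g w d : Gamma).

(** Meant for [d] in [shifts] only; the last branch is the coefficient at [(0, 0)]. *)
Definition coef (d : Gamma) : K :=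
  if d == (2, 0) then a else if d == (1, 0) then - (2 * a)
  else if d == (0, 1) then -1 else a + 1.

Hypotheses (a_neq0 : a != 0) (a_neqN1 : a + 1 != 0).

(** A leading coefficient is [a], [-1] or [a + 1]; the two conditions on [a] make all of them
    invertible. *)
Lemma coef_lead_neq0 g : coef (lead_shift g) != 0.
Proof.
rewrite /lead_shift; do 3?[case: ifP => _]; rewrite /coef //=.
by rewrite oppr_eq0 oner_eq0.
Qed.

Section NormalForm.
Variables (V : lmodType K) (y : Gamma -> V).

Definition shift_sum (f : Gamma -> V) g : V :=
  \sum_(d <- shifts) coef d *: f (g + d).

Definition nf_step (f : Gamma -> V) (w : Gamma) : V :=
  if head_of w is Some g then
    - (coef (lead_shift g))^-1 *:
      \sum_(d <- shifts | d != lead_shift g) coef d *: f (g + d)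
  else y w.

(** Recursion on [weight], with just enough iterations for the value at [w] to be stable; the zero
    function is only a starting point. *)
Definition nf (w : Gamma) : V := iter (weight w).+1 nf_step (fun=> 0) w.

Lemma eq_nf_step (f f' : Gamma -> V) w :
  (forall v, (weight v < weight w)%N -> f v = f' v) -> nf_step f w = nf_step f' w.
Proof.
move=> ff'; rewrite /nf_step; case e: (head_of w) => [g|//]; congr (_ *: _).
rewrite big_seq_cond [RHS]big_seq_cond; apply: eq_bigr => d /andP[dS dl].
by rewrite ff' // (head_ofK e) weight_lead.
Qed.

Lemma nf_stepE w : nf w = nf_step nf w.
Proof.
rewrite {1}/nf iterS; apply: eq_nf_step => v vw.
exact: (iter_stable eq_nf_step).
Qed.

Lemma nf_free w : head_of w = None -> nf w = y w.
Proof. by rewrite nf_stepE /nf_step => ->. Qed.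

Lemma shift_sum_eq0 (f : Gamma -> V) g : shift_sum f g = 0 <->
  f (g + lead_shift g) = - (coef (lead_shift g))^-1 *:
        \sum_(d <- shifts | d != lead_shift g) coef d *: f (g + d).
Proof.
rewrite /shift_sum (bigD1_seq (lead_shift g)) ?lead_shift_in //=; split=> [/eqP|->].
  rewrite addr_eq0 => /eqP e; apply: (scalerI (coef_lead_neq0 g)).
  by rewrite e scalerA mulrN divff ?coef_lead_neq0 // scaleN1r.
by rewrite scalerA mulrN divff ?coef_lead_neq0 // scaleN1r addNr.
Qed.

Lemma nf_shift_sum g : shift_sum nf g = 0.
Proof. by apply/shift_sum_eq0; rewrite nf_stepE {1}/nf_step head_of_lead. Qed.

(** Induction along the rewriting, that is, on [weight], with the non-leaders as base cases. *)
Lemma shift_ind (Q : Gamma -> Prop) :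
  (forall w, head_of w = None -> Q w) ->
  (forall g, (forall d, d \in shifts -> d != lead_shift g -> Q (g + d)) ->
     Q (g + lead_shift g)) ->
  forall w, Q w.
Proof.
move=> Q0 Ql w; have [n] := ubnP (weight w); elim: n w => // n IHn w; rewrite ltnS => wn.
case e: (head_of w) => [g|]; last exact: Q0.
rewrite (head_ofK e); apply: Ql => d dS dl; apply: IHn.
by apply: leq_trans (weight_lead dS dl) _; rewrite -(head_ofK e).
Qed.

(** [J] plays the role of a submodule containing all relations [shift_sum y g]: replacing a leader
    by means of such a relation does not change its class modulo [J]. *)
Lemma nf_congr (J : V -> Prop) :
  J 0 -> (forall u v, J u -> J v -> J (u + v)) -> (forall c u, J u -> J (c *: u)) ->
  (forall g, J (shift_sum y g)) -> forall w, J (y w - nf w).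
Proof.
move=> J0 JD JZ Jy; elim/shift_ind => [w /nf_free ->|g IH].
  by rewrite subrr.
have /shift_sum_eq0 -> := nf_shift_sum g.
have -> : y (g + lead_shift g) = (coef (lead_shift g))^-1 *:
   (shift_sum y g - \sum_(d <- shifts | d != lead_shift g) coef d *: y (g + d)).
  rewrite /shift_sum (bigD1_seq (lead_shift g)) ?lead_shift_in //= addrK scalerA.
  by rewrite mulVf ?coef_lead_neq0 // scale1r.
(* The difference becomes a multiple of [shift_sum y g] plus a combination of the differences
   [nf - y] at the smaller terms, which the induction hypothesis covers. *)
rewrite scaleNr opprK -scalerDr -addrA [- _ + _]addrC -sumrB.
apply: (JZ); apply: (JD) => //; rewrite big_seq_cond.
apply: (@big_ind _ J) => // d /andP[dS dl].
rewrite -scalerBr; apply: (JZ); rewrite -opprB -scaleN1r; exact/JZ/IH.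
Qed.

End NormalForm.

(** * The ideal of the scheme as the kernel of the normal form *)

Hypotheses (a_alpha1 : alpha1 K a = a) (a_alpha2 : alpha2 K a = a).
Implicit Types (B C : sigma_poly K).

Definition scheme (g : Gamma) : sigma_poly K := shift_sum (@term K) g.

Let P : set (sigma_poly K) := sigma_gen [set scheme 0].

(** Both automorphisms fix [a], hence all coefficients, so that a transform only moves the indices
    of the terms. *)
Lemma act_scheme g h : act g (scheme h) = scheme (g + h).
Proof.
rewrite /scheme /shift_sum rmorph_sum /=; apply: eq_bigr => d _.
have f2 : alpha1 K (2 * a) = 2 * a by rewrite rmorphM rmorph_nat a_alpha1.
have f2' : alpha2 K (2 * a) = 2 * a by rewrite rmorphM rmorph_nat a_alpha2.
rewrite actZ act_term addrA actK_fixed // /coef.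
  by do 3?[case: ifP => _]; rewrite ?rmorphN ?rmorphD ?rmorph1 ?f2 ?a_alpha1.
by do 3?[case: ifP => _]; rewrite ?rmorphN ?rmorphD ?rmorph1 ?f2' ?a_alpha2.
Qed.

Lemma scheme_ideal_ideal : is_ideal P. Proof. exact: sigma_gen_ideal. Qed.

Lemma scheme_in_ideal g : P (scheme g).
Proof. by rewrite -(addr0 g) -act_scheme; apply: sigma_gen_act. Qed.

Lemma scheme_ideal_sigma : is_sigma_ideal P.
Proof.
split=> [|g B [s [sA ->]]]; first exact: scheme_ideal_ideal.
rewrite rmorph_sum; apply: (ideal_sum scheme_ideal_ideal) => x /sA xA.
by rewrite rmorphM xA /= !act_scheme; apply/(idealMl scheme_ideal_ideal)/scheme_in_ideal.
Qed.

Lemma term_nf_congr w : P (term K w - nf (@term K) w).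
Proof.
apply: (nf_congr (J := P)).
- exact: ideal0 scheme_ideal_ideal.
- exact: idealD scheme_ideal_ideal.
- exact: idealZ scheme_ideal_ideal.
- exact: scheme_in_ideal.
Qed.

Definition normalize : sigma_poly K -> sigma_poly K :=
  evalm (@malgC {cmonom Gamma} K) (nf (@term K)).
HB.instance Definition _ := GRing.RMorphism.copy normalize
  (evalm (@malgC {cmonom Gamma} K) (nf (@term K))).

Lemma normalize_scheme g : normalize (scheme g) = 0.
Proof.
rewrite rmorph_sum -[RHS](nf_shift_sum (@term K) g); apply: eq_bigr => d _.
rewrite -[RHS]mul_malgC [LHS](evalmZ (@malgC {cmonom Gamma} K)); apply: congr1.
exact: (evalmU (@malgC {cmonom Gamma} K)).
Qed.

(** The generators are sent to zero because [nf] satisfies every transform of the scheme.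
    Conversely, [B] is congruent to [normalize B] modulo [P], since each term is congruent to its
    normal form. *)
Lemma mem_scheme_idealP B : P B <-> normalize B = 0.
Proof.
split=> [[s [sA ->]]|B0].
  rewrite rmorph_sum big_seq big1 // => x /sA xA.
  by rewrite rmorphM xA /= act_scheme normalize_scheme mulr0.
have := evalm_congr scheme_ideal_ideal B term_nf_congr.
by rewrite -/(normalize B) B0 subr0 evalm_id.
Qed.

(** [P] is the kernel of a ring morphism into a polynomial ring, which has no zero divisors. *)
Lemma scheme_ideal_prime : is_prime_ideal P.
Proof.
split=> [||B C].
- exact: scheme_ideal_ideal.
- by rewrite mem_scheme_idealP rmorph1; apply/eqP/oner_neq0.
- by rewrite !mem_scheme_idealP rmorphM; apply: malg_mulf_eq0.
Qed.

Lemma normalize_free B :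
  (forall m w, m \in msupp B -> (0 < m w)%N -> head_of w = None) ->
  normalize B = B.
Proof.
move=> Bfree; rewrite -[RHS]evalm_id; apply: eq_evalm => m w mB mw.
exact: nf_free (Bfree m w mB mw).
Qed.

End Scheme.

(** * The characteristic set *)

(** The leaders at these indices, [(2, 0)], [(-1, 1)], [(1, -1)] and [(-2, -1)], are the corners of
    the four regions that make up the set of leaders. *)
Definition scheme_indices : seq Gamma := [:: 0; (-1, 0); (-1, -1); (-2, -1)].

(** A transform moves each nonzero exponent away from zero. These linear inequalities serve to
    refute transforms by arithmetic. *)
Lemma is_transform_sign v u : is_transform v u ->
  [/\ 0 < u.1 -> u.1 <= v.1, u.1 < 0 -> v.1 <= u.1,
      0 < u.2 -> u.2 <= v.2 & u.2 < 0 -> v.2 <= u.2].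
Proof.
case: u v => u1 u2 [v1 v2] [[k1 k2]] [[e1 e2]] [[-> ->]] []; rewrite /in_orthant /=.
by case: e1 e2 => -[] /andP[? ?] /andP[? ?] /andP[? ?]; split; lia.
Qed.

Lemma head_of_transform w g : head_of w = Some g ->
  exists2 h, h \in scheme_indices & is_transform w (h + lead_shift h).
Proof.
case: w => w1 w2; rewrite /head_of /=; case: ifP => [/orP[w1_ge|/andP[w1_1 w2_lt]] _|_].
(* The leader [(2, 0)] lies on an axis, hence in two orthants; the sign of [w2] selects the one to
   use. *)
- exists 0 => //; exists (w1 - 2, w2), (true, 0 <= w2).
  split; first by congr (_, _) => /=; lia.
  by rewrite /in_orthant /=; case: ifP => ?; split; lia.
- exists (-1, -1) => //; exists (0, w2 + 1), (true, false).
  split; first by congr (_, _) => /=; lia.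
  by rewrite /in_orthant /=; split; lia.
case: ifP => [/andP[w1_lt w2_gt] _|_].
  exists (-1, 0) => //; exists (w1 + 1, w2 - 1), (false, true).
  split; first by congr (_, _) => /=; lia.
  by rewrite /in_orthant /=; split; lia.
case: ifP => [/andP[w1_le w2_lt] _|//].
exists (-2, -1) => //; exists (w1 + 2, w2 + 1), (false, false).
split; first by congr (_, _) => /=; lia.
by rewrite /in_orthant /=; split; lia.
Qed.

(** * The standard ranking *)

Lemma rank_key_inj : injective rank_key.
Proof. by case=> u1 u2 [v1 v2] [] _ _ _ -> ->. Qed.

Lemma term_le_trans : transitive term_le.
Proof. by move=> v u w; apply: le_trans. Qed.

Lemma term_le_anti : antisymmetric term_le.
Proof. by move=> u v /le_anti/rank_key_inj. Qed.

Lemma term_ltNge u v : term_lt u v = ~~ term_le v u.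
Proof. exact: ltNge. Qed.

Lemma term_ltW u v : term_lt u v -> term_le u v.
Proof. exact: ltW. Qed.

(** A form of the ranking suited to linear arithmetic. The comparison of [|u.2|] with [|v.2|]
    disappears: they agree once the orders and the first absolute values do. *)
Lemma term_leE u v : term_le u v =
  (ordG u < ordG v)%N || (ordG u == ordG v) &&
  ((`|u.1| < `|v.1|)%N || (`|u.1|%N == `|v.1|%N) &&
   ((u.1 < v.1) || (u.1 == v.1) && (u.2 <= v.2))).
Proof.
rewrite /term_le /rank_key !lexi_cons lexi0s /ordG /= !implybE.
by case: u v => u1 u2 [v1 v2] /=; lia.
Qed.

(** Inside one orthant orders add up, so a transform by a nontrivial element has strictly larger
    order. *)
Lemma is_transform_le v u : is_transform v u -> term_le u v.
Proof.
case: u v => u1 u2 [v1 v2] [[k1 k2]] [[e1 e2]] [[-> ->]] [].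
rewrite term_leE /ordG /in_orthant /=.
by case: e1 e2 => -[] /andP[? ?] /andP[? ?] /andP[? ?]; lia.
Qed.

Lemma term_le_lead g d : d \in shifts -> term_le (g + d) (g + lead_shift g).
Proof.
case: g => g1 g2; rewrite !inE term_leE /ordG /lead_shift.
by case/or4P => /eqP -> /=; do 3?[case: ifP => ? /=]; lia.
Qed.

Lemma mcoeff_linear (I : choiceType) (R : nzRingType) (T : Type) (s : seq T)
    (c : T -> R) (t : T -> I) (m : {cmonom I}) :
  (\sum_(x <- s) c x *: << ucm (t x) >> : {malg R[{cmonom I}]})@_m =
  \sum_(x <- s) c x * (ucm (t x) == m)%:R.
Proof.
rewrite raddf_sum; apply: eq_bigr => x _ /=.
by rewrite mcoeffZ [X in _ * X]mcoeffU.
Qed.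

Section Leaders.
Variable K : inversive_difference_field.
Implicit Types (B C : sigma_poly K) (u v : Gamma).

Lemma deg_in_gt0 u B : (0 < deg_in u B)%N <-> appears u B.
Proof.
split=> [|[m mB mu0]]; last first.
  by apply: leq_trans mu0 _; apply: (@leq_bigmax_seq _ _ xpredT (fun m : {cmonom Gamma} => m u)).
move=> d0; apply: contrapT => nu; move: d0; rewrite /deg_in big_seq big1 // => m mB.
by apply/eqP; rewrite -leqn0 leqNgt; apply/negP => mu0; apply: nu; exists m.
Qed.

Lemma constant_appears B u : Defs.constant B -> ~ appears u B.
Proof.
move=> [c ->] [m mB]; have := fsubsetP (@msuppC_le _ _ c) _ mB.
by rewrite inE => /eqP ->; rewrite cm1.
Qed.

Lemma is_leader_uniq B u v : is_leader B u -> is_leader B v -> u = v.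
Proof.
move=> [uB leu] [vB lev]; apply: term_le_anti.
by rewrite lev // leu.
Qed.

Lemma rk_lt_irrefl B : ~ rk_lt B B.
Proof.
case=> [[? []] //|[u [v [uB vB]]]]; rewrite -(is_leader_uniq uB vB).
by rewrite term_ltNge /term_le lexx ltnn => -[//|[_]].
Qed.

End Leaders.

Section SchemeLeaders.
Variables (K : inversive_difference_field) (a : K).
Hypotheses (a_neq0 : a != 0) (a_neqN1 : a + 1 != 0).

Lemma scheme_mcoeff g d : d \in shifts -> (scheme a g)@_(ucm (g + d)) = coef a d.
Proof.
move=> dS; rewrite /scheme /shift_sum mcoeff_linear (bigD1_seq d) //= eqxx mulr1.
rewrite big1 ?addr0 // => d' dd'; case: eqP => [e|]; last by rewrite mulr0.
have := congr1 (fun m : {cmonom Gamma} => m (g + d)) e.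
by rewrite /= cmUU cmU (inj_eq (addrI g)) (negPf dd').
Qed.

Lemma scheme_msupp g m : m \in msupp (scheme a g) ->
  exists2 d, d \in shifts & m = ucm (g + d).
Proof.
rewrite -mcoeff_neq0 /scheme /shift_sum mcoeff_linear => nz.
apply: contrapT => nd; case/eqP: nz; rewrite big_seq big1 // => d dS.
by case: eqP => [e|]; [case: nd; exists d | rewrite mulr0].
Qed.

Lemma appears_scheme g v : appears v (scheme a g) ->
  exists2 d, d \in shifts & v = g + d.
Proof.
move=> [m /scheme_msupp[d dS ->]]; rewrite cmU; case: eqP => // <- _.
by exists d.
Qed.

Lemma is_leader_scheme g : is_leader (scheme a g) (g + lead_shift g).
Proof.
split=> [|v /appears_scheme[d dS ->]]; last exact: term_le_lead.
exists (ucm (g + lead_shift g)); last by rewrite cmUU.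
by rewrite -mcoeff_neq0 scheme_mcoeff ?lead_shift_in // coef_lead_neq0.
Qed.

Lemma deg_in_lead_scheme g : deg_in (g + lead_shift g) (scheme a g) = 1%N.
Proof.
apply/eqP; rewrite eqn_leq; apply/andP; split; last first.
  by apply/deg_in_gt0; case: (is_leader_scheme g).
by apply/bigmax_leqP_seq => m /scheme_msupp[d _ ->] _; rewrite cmU leq_b1.
Qed.

(** The leader of [scheme a h] occurs there with degree 1, so being reduced means containing no
    transform of it at all. *)
Lemma reduced_scheme g h :
  (forall d, d \in shifts -> ~ is_transform (g + d) (h + lead_shift h)) ->
  reduced (scheme a g) (scheme a h).
Proof.
move=> gh; exists (h + lead_shift h); split=> [|v vh]; first exact: is_leader_scheme.
rewrite deg_in_lead_scheme ltnNge; apply/negP => /deg_in_gt0/appears_scheme[d dS e].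
by apply: gh dS _; rewrite -e.
Qed.

Local Opaque scheme.

Definition scheme_basis : set (sigma_poly K) :=
  [set B | B \in [seq scheme a g | g <- scheme_indices]].

Lemma scheme_basisP B : scheme_basis B <->
  exists2 g, g \in scheme_indices & B = scheme a g.
Proof. by split=> [/mapP|/mapP]. Qed.

Lemma scheme_not_constant g : ~ Defs.constant (scheme a g).
Proof.
by move=> /constant_appears cA; case: (is_leader_scheme g) => /cA.
Qed.

Lemma scheme_indices_reduced g h : g \in scheme_indices -> h \in scheme_indices ->
  g != h -> forall d, d \in shifts -> ~ is_transform (g + d) (h + lead_shift h).
Proof.
move=> gS hS gh d dS /is_transform_sign.
move: gS hS gh dS; rewrite !inE.
by case/or4P=> /eqP-> /or4P[]/eqP-> // _ /or4P[]/eqP-> [] /=; rewrite /lead_shift /=; lia.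
Qed.

Lemma scheme_basis_autoreduced : autoreduced scheme_basis.
Proof.
split=> [B|B C] /scheme_basisP[g gS ->]; first exact: scheme_not_constant.
move=> /scheme_basisP[h hS ->] gh; apply: reduced_scheme.
apply: (scheme_indices_reduced gS hS).
by apply/eqP => e; apply: gh; rewrite e.
Qed.

(* An autoreduced set of lower rank would contain an element all of whose terms
   are non-leaders, hence equal to its own normal form. *)
Lemma listing_contradiction T s t k :
  autoreduced T -> (forall B, T B -> normalize a B = 0) ->
  increasing_listing T s -> increasing_listing scheme_basis t ->
  (k < size s)%N -> (forall i, (i < k)%N -> (i < size t)%N -> rk_eq s`_i t`_i) ->
  ((k < size t)%N -> rk_lt s`_k t`_k) -> False.
Proof.
move=> [Tnc Tred] TP [Ts s_incr] [St t_incr] ks s_eq s_lt.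
have Tnth i : (i < size s)%N -> T s`_i by move=> si; rewrite Ts; apply: mem_nth.
have Tk := Tnth _ ks.
(* Such an element equals its normal form, which is zero, whereas an autoreduced set contains no
   constant. *)
suff free v : appears v s`_k -> head_of v = None.
  have := TP _ Tk; rewrite normalize_free => [x0|m w mk mw].
    by apply: (Tnc _ Tk); exists 0; rewrite x0 malgC0E.
  by apply: free; exists m.
move=> vk; case e: (head_of v) => [g|//]; exfalso.
have [h hS vh] := head_of_transform e.
have Ah : scheme a h \in t.
  have : scheme_basis (scheme a h) by apply/scheme_basisP; exists h.
  by rewrite St.
have it : (index (scheme a h) t < size t)%N by rewrite index_mem.
have te := nth_index 0 Ah; move: (index _ t) it te => i it te.
have lh := is_leader_scheme h.
(* [i] is the position of the basis element whose leader has [v] as a transform. If [i < k], then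
   [s_i] has that same leader with degree 1, and [s_k] is not reduced with respect to [s_i].
   Otherwise the leader of [s_k] is below that of [t_k], hence below that of [t_i] and below [v],
   although [v] occurs in [s_k]. *)
have [ik|ki] := ltnP i k.
  have [u []] := s_eq i ik it; rewrite te => us uA.
  rewrite -(is_leader_uniq lh uA) deg_in_lead_scheme => ud.
  move: us; rewrite -(is_leader_uniq lh uA) => us.
  have /Tred : T s`_k by [].
  have si := ltn_trans ik ks.
  move=> /(_ _ (Tnth _ si)) [].
    move=> es; apply: (@rk_lt_irrefl _ s`_k); rewrite {1}es.
    by apply: s_incr; rewrite ik ks.
  move=> u' [us' /(_ v)]; rewrite -(is_leader_uniq us us') => /(_ vh).
  by rewrite ud ltnS leqNgt => /negP; apply; apply/deg_in_gt0.
have kt := leq_ltn_trans ki it.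
have [h' tk] : exists h', t`_k = scheme a h'.
  have : scheme_basis t`_k by rewrite St; apply: mem_nth.
  by case/scheme_basisP => h' _ tk; exists h'; exact: tk.
have [[ck _]|[u [u' [us ut ult]]]] := s_lt kt; first exact: Tnc Tk ck.
move: ut; rewrite tk => /(is_leader_uniq (is_leader_scheme h')) eu'.
(* With equal leaders, a degree below 1 would mean that [s_k] does not contain its own leader. *)
have {ult} ult : term_lt u (h' + lead_shift h').
  case: ult => [|[eu]]; first by rewrite eu'.
  rewrite tk eu -eu' deg_in_lead_scheme ltnNge => /negP[].
  by apply/deg_in_gt0; rewrite eu' -eu; case: us.
have ule : term_le (h' + lead_shift h') (h + lead_shift h).
  move: ki; rewrite leq_eqVlt => /predU1P[ki|ki].
    move: tk; rewrite ki te => eh.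
    by rewrite (is_leader_uniq (is_leader_scheme h') (eq_ind _ (fun B => is_leader B _) lh _ eh)) /term_le lexx.
  have := t_incr k i; rewrite ki it tk te => /(_ isT) [[c _]|[w [w' [wh' wh]]]].
    by case: (scheme_not_constant c).
  rewrite -(is_leader_uniq lh wh) -(is_leader_uniq (is_leader_scheme h') wh').
  by case=> [/term_ltW //|[eh]]; rewrite {2}eh !deg_in_lead_scheme.
have := term_le_trans ule (is_transform_le vh).
move=> /term_le_trans/(_ (proj2 us _ vk)); apply/negP.
by rewrite -term_ltNge.
Qed.

Hypotheses (a_alpha1 : alpha1 K a = a) (a_alpha2 : alpha2 K a = a).

Lemma scheme_basis_characteristic :
  is_characteristic_set (sigma_gen [set scheme a 0]) scheme_basis.
Proof.
split=> [|B /scheme_basisP[g _ ->]|T Tred TP [s [t [Ts St lower]]]].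
- exact: scheme_basis_autoreduced.
- exact: scheme_in_ideal.
have TP0 B : T B -> normalize a B = 0.
  by move=> TB; apply/(mem_scheme_idealP a_neq0 a_neqN1 a_alpha1 a_alpha2)/TP.
case: lower => [[k [k_lt eq_k lt_k]]|[ts eq_t]].
  move: k_lt; rewrite leq_min => /andP[ks kt].
  by apply: (listing_contradiction Tred TP0 Ts St ks) => // i ik _; apply: eq_k.
(* When [T] merely extends the list of ranks, [k] is the size of [t]: the first extra element of [T]
   gives the contradiction, and the rank condition at [k] is vacuous. *)
by apply: (listing_contradiction Tred TP0 Ts St ts) => [i it _|]; [apply: eq_t | rewrite ltnn].
Qed.

End SchemeLeaders.

(** * The dimension polynomial *)

Section Residue.
Variables (K : inversive_difference_field) (P : set (sigma_poly K)).
Hypothesis hP : is_prime_ideal P.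
Implicit Types B C : sigma_poly K.

Lemma residue_is_zmod_morphism : zmod_morphism (residue hP).
Proof. by move=> B C; rewrite /residue -rmorphB -rmorphB. Qed.

Lemma residue_is_monoid_morphism : monoid_morphism (residue hP).
Proof.
split=> [|B C]; first by rewrite /residue !rmorph1.
by rewrite /residue -rmorphM -rmorphM.
Qed.

HB.instance Definition _ := GRing.isZmodMorphism.Build (sigma_poly K)
  (residue_field hP) (residue hP) residue_is_zmod_morphism.
HB.instance Definition _ := GRing.isMonoidMorphism.Build (sigma_poly K)
  (residue_field hP) (residue hP) residue_is_monoid_morphism.

Lemma residue_eq0 B : residue hP B = 0 <-> P B.
Proof.
have -> : residue hP B = 0 <-> residue hP B == residue hP 0.
  by rewrite rmorph0; split=> /eqP.
rewrite /residue tofrac_eq -(Quotient.idealrBE (prime_ideal hP)) subr0.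
by split=> /asboolP.
Qed.

End Residue.

(** * Subfields generated over the base field *)

Section Adjoin.
Variables (k F : fieldType) (iota : k -> F).
Implicit Types (S T : set F) (E : {pred F}).

(** The boolean form allows [adjoin] itself as a test subfield [E] in the definition of [adjoin],
    which yields its minimality in [adjoin_sub]. *)
Lemma adjoin_divring_closed S : divring_closed (fun x => `[< adjoin iota S x >]).
Proof.
split=> [|x y /asboolP Sx /asboolP Sy|x y /asboolP Sx /asboolP Sy];
  apply/asboolP => E E_cl Ek ES; have [E1 EB EV] := E_cl => //.
- by apply: EB; [apply: Sx | apply: Sy].
- by apply: EV; [apply: Sx | apply: Sy].
Qed.

Lemma adjoin_iota S c : adjoin iota S (iota c).
Proof. by move=> E _ Ek _; apply: Ek. Qed.

Lemma sub_adjoin S x : S x -> adjoin iota S x.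
Proof. by move=> Sx E _ _; apply. Qed.

Lemma adjoin_sub S T : (forall x, S x -> adjoin iota T x) ->
  forall x, adjoin iota S x -> adjoin iota T x.
Proof.
move=> ST x /(_ (fun x => `[< adjoin iota T x >])) Sx; apply/asboolP/Sx.
- exact: adjoin_divring_closed.
- by move=> c; apply/asboolP/adjoin_iota.
- by move=> s /ST Ts; apply/asboolP.
Qed.

Section Closure.
Variable S : set F.
Let E_cl := adjoin_divring_closed S.

Lemma adjoinB x y : adjoin iota S x -> adjoin iota S y -> adjoin iota S (x - y).
Proof. by case: E_cl => _ + _ Sx Sy => /(_ x y) h; apply/asboolP/h; apply/asboolP. Qed.

Lemma adjoin1 : adjoin iota S 1. Proof. by case: E_cl => /asboolP. Qed.

Lemma adjoin0 : adjoin iota S 0.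
Proof. by rewrite -(subrr 1); apply: adjoinB adjoin1 adjoin1. Qed.

Lemma adjoinN x : adjoin iota S x -> adjoin iota S (- x).
Proof. by rewrite -sub0r; apply: adjoinB adjoin0. Qed.

Lemma adjoinD x y : adjoin iota S x -> adjoin iota S y -> adjoin iota S (x + y).
Proof. by move=> Sx Sy; rewrite -(opprK y); apply/adjoinB/adjoinN. Qed.

Lemma adjoin_div x y : adjoin iota S x -> adjoin iota S y -> adjoin iota S (x / y).
Proof. by case: E_cl => _ _ + Sx Sy => /(_ x y) h; apply/asboolP/h; apply/asboolP. Qed.

Lemma adjoinM x y : adjoin iota S x -> adjoin iota S y -> adjoin iota S (x * y).
Proof.
move=> Sx Sy; rewrite -(invrK y) -(div1r y).
exact/adjoin_div/adjoin_div/Sy/adjoin1.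
Qed.

Lemma adjoin_algebraic x : adjoin iota S x -> algebraic_over (adjoin iota S) x.
Proof.
move=> Sx; exists ('X - x%:P); rewrite polyXsubC_eq0 root_XsubC; split=> // i.
rewrite coefB coefX coefC; apply: adjoinB.
  by case: (i == 1)%N; [apply: adjoin1 | apply: adjoin0].
by case: (i == 0)%N; [apply: Sx | apply: adjoin0].
Qed.

End Closure.
End Adjoin.

(* The five families of r non-leaders each; the last one is (- k, 0) with
   k = 0, 2, ..., r. *)
Definition nonleader (q m : nat) : Gamma :=
  match q with
  | 0 => (1, m%:Z)
  | 1 => (-1, - m%:Z)
  | 2 => (0, m.+1%:Z)
  | 3 => (0, - m.+1%:Z)
  | _ => (- (m + (0 < m))%N%:Z, 0)
  end.

Definition nonleaders (r : nat) : seq Gamma :=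
  [seq nonleader q m | q <- iota 0 5, m <- iota 0 r].

Lemma size_nonleaders r : size (nonleaders r) = (5 * r)%N.
Proof. by rewrite size_allpairs !size_iota. Qed.

(** The only possible overlap, at [(-1, 0)], is avoided because the last family skips [k = 1]. *)
Lemma nonleaders_uniq r : uniq (nonleaders r).
Proof.
have lt5 p : p \in [seq (q, m) | q <- iota 0 5, m <- iota 0 r] -> (p.1 < 5)%N.
  by case/allpairsP => x [xS _ ->]; rewrite mem_iota in xS.
apply: allpairs_uniq; rewrite ?iota_uniq // => -[q m] [q' m'] /lt5 qS /lt5 q'S.
move: qS q'S => /=.
do 5?[case: q => [|q] //]; do 5?[case: q' => [|q'] //]; move=> _ _ /= [] *;
  first [exfalso; lia | congr (_, _); lia].
Qed.

(** For [r = 0] the list is empty although [(0, 0)] is a non-leader of order 0, whence the condition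
    on [r]. *)
Lemma mem_nonleaders r w : (0 < r)%N ->
  (w \in nonleaders r) = (head_of w == None) && (ordG w <= r)%N.
Proof.
move=> r0; apply/idP/idP.
  case/allpairsP => -[q m] /= []; rewrite !mem_iota !add0n => q5 mr ->.
  rewrite /head_of /ordG.
  by do 5?[case: q q5 => [|q] q5 //=]; do ?[case: ifP => ? //=]; lia.
move=> /andP[/eqP hw wr]; apply/allpairsP.
suff [[q m] [q5 mr e]] : exists p : nat * nat, [/\ (p.1 < 5)%N, (p.2 < r)%N & w = nonleader p.1 p.2].
  by exists (q, m); rewrite !mem_iota.
case: w hw wr => w1 w2; rewrite /head_of /ordG /=.
do 3?[case: ifP => // ?]; move=> _ wr.
have [w11|w11] := eqVneq w1 1.
  by exists (0%N, `|w2|%N); split=> //=; [lia | congr (_, _); lia].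
have [w11'|w11'] := eqVneq w1 (-1).
  by exists (1%N, `|w2|%N); split=> //=; [lia | congr (_, _); lia].
(* If [w1] is nonzero here, it is at most -2, and a non-leader then has [w2 = 0]. *)
have [w10|w10] := eqVneq w1 0; last first.
  by exists (4%N, `|w1|.-1%N); split=> //=; [lia | congr (_, _); lia].
case: (ltrgtP w2 0) => w20.
- by exists (3%N, `|w2|.-1%N); split=> //=; [lia | congr (_, _); lia].
- by exists (2%N, `|w2|.-1%N); split=> //=; [lia | congr (_, _); lia].
- by exists (4%N, 0%N); split=> //=; congr (_, _); lia.
Qed.

Section Dimension.
Variables (K : inversive_difference_field) (a : K).
Hypotheses (a_neq0 : a != 0) (a_neqN1 : a + 1 != 0).
Hypotheses (a_alpha1 : alpha1 K a = a) (a_alpha2 : alpha2 K a = a).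

Let P : set (sigma_poly K) := sigma_gen [set scheme a 0].
Let hP : is_prime_ideal P := scheme_ideal_prime a_neq0 a_neqN1 a_alpha1 a_alpha2.
Let iota (c : K) : residue_field hP := residue hP c%:MP.

Lemma residueZ c (B : sigma_poly K) : residue hP (c *: B) = iota c * residue hP B.
Proof. by rewrite -mul_malgC rmorphM. Qed.

(** Rewriting uses coefficients from [K] and never raises the order, so a term of order at most [r]
    reduces to non-leaders of order at most [r]. *)
Lemma residue_term_adjoin (S : set (residue_field hP)) r :
  (forall w, head_of w = None -> (ordG w <= r)%N -> S (residue hP (term K w))) ->
  forall w, (ordG w <= r)%N -> adjoin iota S (residue hP (term K w)).
Proof.
move=> Sfree w.
have -> : residue hP (term K w) = residue hP (nf a (@term K) w).
  apply/eqP; rewrite -subr_eq0 -rmorphB; apply/eqP/residue_eq0.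
  exact: term_nf_congr.
elim/shift_ind: w => [w w0 wr|g IH gr].
  by rewrite nf_free //; apply/sub_adjoin/Sfree.
have /(shift_sum_eq0 a_neq0 a_neqN1) -> := nf_shift_sum a_neq0 a_neqN1 (@term K) g.
rewrite residueZ rmorph_sum; apply: adjoinM; first exact: adjoin_iota.
rewrite big_seq_cond; apply: (@big_ind _ (adjoin iota S)).
- exact: adjoin0.
- exact: adjoinD.
move=> d /andP[dS dl]; rewrite /= residueZ; apply: adjoinM; first exact: adjoin_iota.
by apply: IH => //; apply: leq_trans (weight_ordG (weight_lead dS dl)) gr.
Qed.

(** A relation [p] between the residues lifts to an element [q] of [P] containing no leader; [q] is
    its own normal form, hence zero. *)
Lemma residue_algebraically_independent n (w : 'I_n -> Gamma) :
  injective w -> (forall i, head_of (w i) = None) ->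
  algebraically_independent iota (fun i => residue hP (term K (w i))).
Proof.
move=> w_inj w_free p p0.
pose q := evalm (@malgC {cmonom Gamma} K) (fun i => term K (w i)) p.
have q0 : q = 0.
  have /residue_eq0/(mem_scheme_idealP a_neq0 a_neqN1 a_alpha1 a_alpha2) : residue hP q = 0.
    by rewrite -[RHS]p0; apply: rmorph_evalm.
  move=> <-; rewrite (rmorph_evalm (h := normalize a) (g := @malgC {cmonom Gamma} K)).
    apply: eq_evalm => m i _ _ /=.
    by rewrite /normalize evalmU nf_free.
  by move=> c; apply: (evalmC (@malgC {cmonom Gamma} K)).
(* As [w] is injective, renaming the terms back into the indeterminates recovers [p] from [q]. *)
pose back (v : Gamma) : {malg K[{cmonom 'I_n}]} :=
  if [pick i | w i == v] is Some i then << ucm i >> else 0.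
rewrite -[p]evalm_id -[RHS](rmorph0 (evalm (@malgC {cmonom 'I_n} K) back)) -q0.
rewrite (rmorph_evalm (g := @malgC {cmonom 'I_n} K)).
  apply: eq_evalm => m i _ _ /=; rewrite (evalmU (@malgC {cmonom 'I_n} K)) /back.
  by case: pickP => [j /eqP/w_inj ->|/(_ i)]; rewrite ?eqxx.
by move=> c; apply: (evalmC (@malgC {cmonom 'I_n} K)).
Qed.

Lemma scheme_dimension_polynomial : is_dimension_polynomial P (5 *: 'X).
Proof.
exists hP, 1%N => r r0; exists (5 * r)%N; split.
  by rewrite hornerZ hornerX natrM.
pose w (i : 'I_(5 * r)) := nth 0 (nonleaders r) i.
have w_mem i : w i \in nonleaders r by rewrite mem_nth // size_nonleaders.
have w_free i : head_of (w i) = None.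
  by have := w_mem i; rewrite mem_nonleaders // => /andP[/eqP].
have w_inj : injective w.
  move=> i j /eqP; rewrite nth_uniq ?size_nonleaders ?nonleaders_uniq //.
  by move=> /eqP/val_inj.
exists (fun i => residue hP (term K (w i))); split.
- move=> i; apply: sub_adjoin; exists (w i) => //=.
  by have := w_mem i; rewrite mem_nonleaders // => /andP[].
- exact: residue_algebraically_independent.
(* The chosen residues already generate the whole field of order [r], so algebraicity is
   immediate. *)
move=> x Lx; apply: adjoin_algebraic; move: x Lx; apply: adjoin_sub => _ [g gr <-].
apply: (@residue_term_adjoin _ r) gr => v v0 vr.
have : v \in nonleaders r by rewrite mem_nonleaders // v0 vr.
move=> vS; have vi : (index v (nonleaders r) < 5 * r)%N.
  by rewrite -size_nonleaders index_mem.
have we : w (Ordinal vi) = v by apply: nth_index.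
by exists (Ordinal vi); [exact: I | rewrite -[in RHS]we].
Qed.

End Dimension.

(** * The scheme and its transforms in explicit form *)

Lemma shift_sumE (K : inversive_difference_field) (a : K) (V : lmodType K)
    (f : Gamma -> V) (i j : int) : shift_sum a f (i, j) =
  a *: f (i + 2, j) - (2 * a) *: f (i + 1, j) - f (i, j + 1) + (a + 1) *: f (i, j).
Proof.
rewrite /shift_sum !big_cons big_nil /coef /= !addGE /= !addr0.
by rewrite !scaleNr scale1r !addrA.
Qed.

Lemma act_scheme0 (K : inversive_difference_field) (a : K)
    (a_alpha1 : alpha1 K a = a) (a_alpha2 : alpha2 K a = a) g :
  act g (scheme a 0) = scheme a g.
Proof. by rewrite (act_scheme a_alpha1 a_alpha2) addr0. Qed.

(** With [p], [q], [r], [s] the values at [(x+2h, t)], [(x+h, t)], [(x, t+h)], [(x, t)], the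
    right-hand side is [a] times the second difference in space minus the first difference in
    time. *)
Lemma forward_differenceE (R : pzRingType) (a : R) (V : lmodType R) (p q r s : V) :
  a *: p - (2 * a) *: q - r + (a + 1) *: s =
  a *: (p - 2 *: q + s) - (r - s).
Proof.
rewrite scalerDr scalerBr scalerA scalerDl scale1r opprB mulr_natr mulr_natl.
by rewrite !addrA [LHS](ACl (1*2*4*5*3)).
Qed.

(** These are the orders in which the summands of [A2], [A3] and [A4] are displayed. *)
Lemma permute_summands (V : zmodType) (p q r s : V) :
  [/\ p - q - r + s = - r + p + s - q, p - q - r + s = p + s - r - q
    & p - q - r + s = s - r - q + p].
Proof.
by split; [rewrite (ACl (3*1*4*2)) | rewrite (ACl (1*4*3*2)) | rewrite (ACl (4*3*2*1))].
Qed.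

(** The function [a = c/h] is constant, hence fixed by both translations. Its nonvanishing and that
    of [a + 1] make the stated leaders occur: [a] is the leading coefficient of [A1] and [A3], and
    [a + 1] that of [A4]. *)
Theorem mainTheorem4 (K : inversive_difference_field) (a : K)
    (a_alpha1 : alpha1 K a = a) (a_alpha2 : alpha2 K a = a)
    (a_neq0 : a != 0) (a_neqN1 : a + 1 != 0) :
  let y (i j : int) : sigma_poly K := term K (i, j) in
  let A : sigma_poly K :=
    a *: y 2 0 - (2 * a) *: y 1 0 - y 0 1 + (a + 1) *: y 0 0 in
  let P : set (sigma_poly K) := sigma_gen [set A] in
  let A1 := A in
  let A2 := act (- 1, 0) A in
  let A3 := act (- 1, - 1) A in
  let A4 := act (- 2, - 1) A in
  [/\ A = a *: (y 2 0 - 2 *: y 1 0 + y 0 0) - (y 0 1 - y 0 0),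
      [/\ is_sigma_ideal P, is_linear_ideal P & is_prime_ideal P],
      [/\ A2 = - y (- 1) 1 + a *: y 1 0 + (a + 1) *: y (- 1) 0
               - (2 * a) *: y 0 0,
          A3 = a *: y 1 (- 1) + (a + 1) *: y (- 1) (- 1) - y (- 1) 0
               - (2 * a) *: y 0 (- 1)
        & A4 = (a + 1) *: y (- 2) (- 1) - y (- 2) 0
               - (2 * a) *: y (- 1) (- 1) + a *: y 0 (- 1)],
      is_characteristic_set P [set B | B \in [:: A1; A2; A3; A4]] /\
      [/\ is_leader A1 (2, 0), is_leader A2 (- 1, 1),
          is_leader A3 (1, - 1) & is_leader A4 (- 2, - 1)]
    & is_dimension_polynomial P (5 *: 'X)].
Proof.
move=> y A P A1 A2 A3 A4.
have schemeE i j : scheme a (i, j) =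
    a *: y (i + 2) j - (2 * a) *: y (i + 1) j - y i (j + 1) + (a + 1) *: y i j.
  exact: shift_sumE.
have AE : A = scheme a 0 by rewrite schemeE.
have actE g : act g A = scheme a g := eq_trans (congr1 (act g) AE) (act_scheme0 a_alpha1 a_alpha2 g).
have [A2E A3E A4E] : [/\ A2 = scheme a (-1, 0), A3 = scheme a (-1, -1)
  & A4 = scheme a (-2, -1)] by split; apply: actE.
have PE : P = sigma_gen [set scheme a 0] := congr1 (fun B => sigma_gen [set B]) AE.
split.
- exact: forward_differenceE.
- rewrite PE; split.
  + exact: scheme_ideal_sigma.
  + exists [set scheme a 0]; split=> // B -> m /scheme_msupp[d _ ->].
    exact: mdegU.
  + exact: scheme_ideal_prime.
- split.
  + rewrite A2E (schemeE (-1) 0).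
    by have [e _ _] := permute_summands (a *: y 1 0) ((2 * a) *: y 0 0) (y (-1) 1)
      ((a + 1) *: y (-1) 0); exact: e.
  + rewrite A3E (schemeE (-1) (-1)).
    by have [_ e _] := permute_summands (a *: y 1 (-1)) ((2 * a) *: y 0 (-1))
      (y (-1) 0) ((a + 1) *: y (-1) (-1)); exact: e.
  + rewrite A4E (schemeE (-2) (-1)).
    by have [_ _ e] := permute_summands (a *: y 0 (-1)) ((2 * a) *: y (-1) (-1))
      (y (-2) 0) ((a + 1) *: y (-2) (-1)); exact: e.
- rewrite PE A2E A3E A4E /A1 AE; split; first exact: scheme_basis_characteristic.
  by split; apply: (@is_leader_scheme _ _ a_neq0 a_neqN1 (_, _)).
- by rewrite PE; apply: scheme_dimension_polynomial.
Qed.
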